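(* With probability one there exists $n_0$ such that for every $n\ge n_0$ the function $\mathbb R^2\ni(\alpha',\theta')\mapsto Q_n(\mathbf Y_n;\alpha',\theta')$ has a unique global minimizer, denoted $(\tilde\alpha_n,\tilde\theta_n)$. Moreover, for every $(\alpha,\theta)\in(0,1)\times\mathbb N$, $$\mathbb P\Big(\lim_{n\to\infty}\tilde\alpha_n=\alpha\Big)=1,\qquad \mathbb P\Big(\lim_{n\to\infty}\tilde\theta_n=Y_s-\frac{\alpha}{1+\alpha^2}(Y_{s-1}+Y_{s+1})-\frac{1-\alpha}{1+\alpha^2}\mu_\varepsilon\Big)=1 .$$
   Context: INAR(1) process: Let $\alpha\in(0,1)$. Let $(\varepsilon_k)_{k\in\mathbb N}$ be i.i.d. non-negative integer-valued random variables with $\mathbb E\varepsilon_1^2<\infty$ and $\mathbb P(\varepsilon_1\ne 0)>0$; write $\mu_\varepsilon=\mathbb E\varepsilon_1$ (assumed known) and $\sigma_\varepsilon^2=\operatorname{Var}\varepsilon_1$. For each $k\in\mathbb N$ let $(\xi_{k,j})_{j\in\mathbb N}$ be i.i.d. Bernoulli random variables with mean $\alpha$, these sequences being mutually independent and independent of $(\varepsilon_k)$. Let $X_0$ be a non-negative integer-valued random variable with $\mathbb E X_0^2<\infty$, independent of all $\xi_{k,j}$ and $\varepsilon_k$, and set $X_k=\sum_{j=1}^{X_{k-1}}\xi_{k,j}+\varepsilon_k$ for $k\in\mathbb N$. Additive outlier: fix a known time $s\in\mathbb N$ and an unknown size $\theta\in\mathbb N$, and let $Y_k=X_k+\delta_{k,s}\theta$,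 $k\in\mathbb Z_+$ ($\delta$ the Kronecker delta). Write $\mathbf Y_n=(Y_0,\dots,Y_n)$ and $\mathbf y_n=(y_0,\dots,y_n)\in\mathbb R^{n+1}$. For $n\ge s+1$ and $\alpha',\theta'\in\mathbb R$ define $$Q_n(\mathbf y_n;\alpha',\theta')=\sum_{\substack{k=1\\k\notin\{s,s+1\}}}^n(y_k-\alpha'y_{k-1}-\mu_\varepsilon)^2+(y_s-\alpha'y_{s-1}-\mu_\varepsilon-\theta')^2+(y_{s+1}-\alpha'y_s-\mu_\varepsilon+\alpha'\theta')^2 .$$ *)

(* Defs.v *)
From HB Require Import structures.
From mathcomp Require Import all_boot all_order all_algebra.
From mathcomp Require Import all_classical all_reals all_analysis.
Set Implicit Arguments. Unset Strict Implicit. Unset Printing Implicit Defensive.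
Import Order.TTheory GRing.Theory Num.Theory.
Import numFieldNormedType.Exports.
Local Open Scope classical_set_scope.
Local Open Scope ring_scope.

Definition mutually_independent {d} {T : measurableType d} {R : realType}
  (P : probability T R) {I : eqType} (Z : I -> T -> nat) : Prop :=
  forall (s : seq I), uniq s -> forall B : I -> set nat,
    P (\bigcap_(i in [set` s]) (Z i @^-1` B i)) =
    (\prod_(i <- s) P (Z i @^-1` B i))%E.

(* Index set of all the primitive random variables of the INAR(1) model:
   inl tt            ~ X_0,
   inr (inl k)       ~ eps_{k+1},
   inr (inr (k, j))  ~ xi_{k+1, j+1}. *)
Definition inar_family {T : Type} (X0 : T -> nat) (eps : nat -> T -> nat)
  (xi : nat -> nat -> T -> nat) : (unit + (nat + (nat * nat)))%type -> T -> nat :=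
  fun i => match i with
           | inl _ => X0
           | inr (inl k) => eps k
           | inr (inr (k, j)) => xi k j
           end.

(* The INAR(1) process: X_0 = X0, X_{k+1} = sum_{j=1}^{X_k} xi_{k+1,j} + eps_{k+1}
   (with the shifted indexing eps k = eps_{k+1}, xi k j = xi_{k+1,j+1}). *)
Fixpoint inarX {T : Type} (X0 : T -> nat) (eps : nat -> T -> nat)
  (xi : nat -> nat -> T -> nat) (k : nat) (w : T) : nat :=
  match k with
  | 0 => X0 w
  | k'.+1 => (\sum_(j < inarX X0 eps xi k' w) xi k' j w + eps k' w)%N
  end.

Definition inarY {R : realType} {T : Type} (X0 : T -> nat) (eps : nat -> T -> nat)
  (xi : nat -> nat -> T -> nat) (s theta : nat) (k : nat) (w : T) : R :=
  (inarX X0 eps xi k w)%:R + (if k == s then theta%:R else 0).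

Definition Qn {R : realType} (mu : R) (s n : nat) (y : nat -> R) (a t : R) : R :=
  \sum_(1 <= k < n.+1 | (k != s) && (k != s.+1)) (y k - a * y k.-1 - mu) ^+ 2
  + (y s - a * y s.-1 - mu - t) ^+ 2
  + (y s.+1 - a * y s - mu + a * t) ^+ 2.

Definition is_global_min {R : realType} (f : R -> R -> R) (a t : R) : Prop :=
  forall a' t', f a t <= f a' t'.

Definition has_unique_global_min {R : realType} (f : R -> R -> R) : Prop :=
  exists a t, is_global_min f a t /\
    forall a' t', is_global_min f a' t' -> a' = a /\ t' = t.

(* Main.v *)
(* For fixed a the objective Q_n(a, t) is minimized in t at an explicit point, which
   leaves a one-variable profile A_n a^2 - 2 B_n a + h(a), where h does not depend on n and
   has bounded second differences.  So everything follows once A_n tends to infinity and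
   B_n / A_n tends to alpha almost surely.  The first holds because X_{k+1} >= eps_{k+1}.
   For the second, put M_{k+1} = X_{k+1} - alpha X_k - mu and b_n = 1 + \sum_{k<n} X_k^2.
   Only second moments are available, so \sum_k X_k M_{k+1} need not be square integrable;
   but b_{n+1} is known at time n, and X_k^2 E[M_{k+1}^2 | past] / b_{k+1}^2 is bounded by
   a multiple of b_k^{-1/2} - b_{k+1}^{-1/2}.  Hence, for W_n = b_n^{-1} \sum_{N<=k<n} X_k M_{k+1}
   stopped on leaving (-e, e), the process W_n^2 + K b_n^{-1/2} is a supermartingale from
   time N on, and P(sup_n |W_n| >= e) <= K e^{-2} E[b_N^{-1/2}] tends to 0 with N. *)
Require Import Defs.
From HB Require Import structures.
From mathcomp Require Import all_boot all_order all_algebra.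
From mathcomp Require Import all_classical all_reals all_analysis.
From mathcomp Require Import measurable_realfun.
From mathcomp Require Import ring lra.
Set Implicit Arguments. Unset Strict Implicit. Unset Printing Implicit Defensive.
Import Order.TTheory GRing.Theory Num.Theory.
Import numFieldNormedType.Exports.
Local Open Scope classical_set_scope.
Local Open Scope ring_scope.

(** * The least squares criterion *)

Definition nonoutlier (s k : nat) : bool := (k != s) && (k != s.+1).

Definition regA {R : realType} (s n : nat) (y : nat -> R) : R :=
  \sum_(1 <= k < n.+1 | nonoutlier s k) y k.-1 ^+ 2.

Definition regB {R : realType} (mu : R) (s n : nat) (y : nat -> R) : R :=
  \sum_(1 <= k < n.+1 | nonoutlier s k) (y k - mu) * y k.-1.

(** With p = y_s - a y_{s-1} - mu and q = y_{s+1} - a y_s - mu, the outlier terms are (p - t)^2 + (q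
    + a t)^2. This is their minimizer (p - a q) / (1 + a^2) in t. *)
Definition outlier_hat {R : realType} (mu : R) (s : nat) (y : nat -> R) (a : R) : R :=
  y s - a / (1 + a ^+ 2) * (y s.-1 + y s.+1) - (1 - a) / (1 + a ^+ 2) * mu.

(** The minimum over t of the two outlier terms, (q + a p)^2 / (1 + a^2) in the same notation; y_s
    cancels in q + a p. *)
Definition penalty {R : realType} (mu : R) (s : nat) (y : nat -> R) (a : R) : R :=
  (y s.+1 - mu - mu * a - y s.-1 * a ^+ 2) ^+ 2 / (1 + a ^+ 2).

Definition profile {R : realType} (mu : R) (s n : nat) (y : nat -> R) (a : R) : R :=
  regA s n y * a ^+ 2 - 2 * regB mu s n y * a + penalty mu s y a.

Lemma sqr1_gt0 {R : realType} (a : R) : 0 < 1 + a ^+ 2.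
Proof. by rewrite ltr_pwDl // sqr_ge0. Qed.

Lemma Qn_profile {R : realType} (mu : R) (s n : nat) (y : nat -> R) :
  exists C : R, forall a t : R,
  Qn mu s n y a t = C + profile mu s n y a
    + (1 + a ^+ 2) * (t - outlier_hat mu s y a) ^+ 2.
Proof.
exists (\sum_(1 <= k < n.+1 | nonoutlier s k) (y k - mu) ^+ 2) => a t.
have a0 : 1 + a ^+ 2 != 0 by rewrite gt_eqF // sqr1_gt0.
rewrite /Qn /profile /regA /regB /nonoutlier.
have -> : \sum_(1 <= k < n.+1 | (k != s) && (k != s.+1))
    (y k - a * y k.-1 - mu) ^+ 2 =
  \sum_(1 <= k < n.+1 | (k != s) && (k != s.+1)) (y k - mu) ^+ 2
  - 2 * (\sum_(1 <= k < n.+1 | (k != s) && (k != s.+1)) (y k - mu) * y k.-1) * a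
  + (\sum_(1 <= k < n.+1 | (k != s) && (k != s.+1)) y k.-1 ^+ 2) * a ^+ 2.
  rewrite [2 * _]mulrC -mulrA !big_distrl /= -sumrN -!big_split /=.
  by apply: eq_bigr => k _; ring.
by rewrite /penalty /outlier_hat; field.
Qed.

(** The factor 1 + a^2 of the completed square is positive, so t must annihilate that square,
    whatever a is. What remains is a minimization in a alone. *)
Lemma is_global_min_profile {R : realType} (mu : R) (s n : nat) (y : nat -> R) (a t : R) :
  is_global_min (Qn mu s n y) a t <->
  (forall a', profile mu s n y a <= profile mu s n y a') /\
  t = outlier_hat mu s y a.
Proof.
have [C QE] := Qn_profile mu s n y; split.
- move=> m.
  have tE : t = outlier_hat mu s y a.
    have := m a (outlier_hat mu s y a).
    rewrite !QE subrr expr0n mulr0 addr0 gerDl => h.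
    have : (t - outlier_hat mu s y a) ^+ 2 <= 0.
      by move: h; rewrite pmulr_rle0 // sqr1_gt0.
    rewrite le_eqVlt ltNge sqr_ge0 orbF sqrf_eq0 subr_eq0.
    by move/eqP.
  split=> // a'.
  have := m a' (outlier_hat mu s y a').
  by rewrite !QE -tE !subrr expr0n !mulr0 !addr0 lerD2l.
- move=> [m ->] a' t'; rewrite !QE subrr expr0n mulr0 addr0.
  rewrite -addrA lerD2l; apply: (le_trans (m a')).
  by rewrite lerDl mulr_ge0 ?sqr_ge0 // ltW // sqr1_gt0.
Qed.

(** * Existence and uniqueness of the minimizer of the profile *)

Lemma cvg_sqr {R : realType} {I : Type} {F : set_system I} {FF : Filter F}
  (f : I -> R) (l : R) : f @ F --> l -> (fun i => f i ^+ 2) @ F --> l ^+ 2.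
Proof. by move=> fl; rewrite expr2; apply: cvgM. Qed.

Lemma profile_continuous {R : realType} (mu : R) (s n : nat) (y : nat -> R) :
  continuous (profile mu s n y).
Proof.
move=> a; rewrite /profile /penalty.
have ca : x ^+ 2 @[x --> a] --> a ^+ 2 by apply: cvg_sqr; exact: cvg_id.
apply: cvgD; first apply: cvgB.
- by apply: cvgM => //; exact: cvg_cst.
- by apply: cvgM; [exact: cvg_cst | exact: cvg_id].
- apply: cvgM.
    apply: cvg_sqr; apply: cvgB; last by apply: cvgM => //; exact: cvg_cst.
    apply: cvgB; first exact: cvg_cst.
    by apply: cvgM; [exact: cvg_cst | exact: cvg_id].
  apply: cvgV; first by rewrite gt_eqF // sqr1_gt0.
  by apply: cvgD => //; exact: cvg_cst.
Qed.

Lemma penalty_ge0 {R : realType} (mu : R) (s : nat) (y : nat -> R) (a : R) :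
  0 <= penalty mu s y a.
Proof. by rewrite /penalty mulr_ge0 ?sqr_ge0 // invr_ge0 ltW // sqr1_gt0. Qed.

(** Coercivity: since A >= 1 and the penalty is nonnegative, the profile is at least a^2 - 2 |B|
    |a|, which exceeds its value at 0 outside a compact interval. *)
Lemma profile_has_min {R : realType} (mu : R) (s n : nat) (y : nat -> R) :
  1 <= regA s n y ->
  exists a, forall a', profile mu s n y a <= profile mu s n y a'.
Proof.
move=> A1; set g := profile mu s n y.
(* Beyond L one has |a'| - 2 |B| >= 1 + |g 0| and |a'| >= 1, hence g a' >= |g 0|. *)
set B := regB mu s n y; set L := 2 * `|B| + 1 + `|g 0|.
have L0 : 1 <= L by rewrite /L; have := normr_ge0 B; have := normr_ge0 (g 0); lra.
have [||a _ am] := @EVT_min R g (- L) L.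
- by lra.
- by apply: continuous_subspaceT => x; exact: profile_continuous.
exists a => a'.
have [aL|aL] := leP `|a'| L.
  by apply: am; rewrite in_itv /= -ler_norml.
apply: (@le_trans _ _ (g 0)).
  by apply: am; rewrite in_itv /=; lra.
apply: (@le_trans _ _ `|g 0|); first exact: ler_norm.
rewrite /g /profile -/B.
have h1 : `|a'| ^+ 2 <= regA s n y * a' ^+ 2.
  by rewrite real_normK ?num_real // ler_peMl // sqr_ge0.
have h2 : B * a' <= `|B| * `|a'| by rewrite -normrM ler_norm.
have h3 := penalty_ge0 mu s y a'.
have h4 := normr_ge0 (g 0); have h5 := normr_ge0 B.
have h6 : `|a'| * (1 + `|g 0|) <= `|a'| * (`|a'| - 2 * `|B|).
  by apply: ler_wpM2l => //; move: aL; rewrite /L; lra.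
have h7 : 1 + `|g 0| <= `|a'| * (1 + `|g 0|) by apply: ler_peMl; lra.
have : `|g 0| <= `|a'| ^+ 2 - 2 * (`|B| * `|a'|).
  by rewrite expr2; lra.
lra.
Qed.

(* With f x = 1 / (1 - i x) = (1 + i x) / (1 + x^2), the second difference
   f (m + d) + f (m - d) - 2 f m equals -2 d^2 f m f (m + d) f (m - d), and |f| <= 1. *)
Lemma second_difference_bound {R : realType} (r0 r1 m d : R)
    (rho := fun x : R => (r0 + r1 * x) / (1 + x ^+ 2)) :
  `|rho (m + d) + rho (m - d) - 2 * rho m| <= 8 * (`|r0| + `|r1|) * d ^+ 2.
Proof.
(* The real and imaginary parts of f; thus [rho] is r0 [u] + r1 [v]. *)
pose u (x : R) := 1 / (1 + x ^+ 2); pose v (x : R) := x / (1 + x ^+ 2).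
have n0 (x : R) : 1 + x ^+ 2 != 0 by rewrite gt_eqF // sqr1_gt0.
have u1 x : `|u x| <= 1.
  rewrite /u div1r normfV (ger0_norm (ltW (sqr1_gt0 x))).
  by rewrite invf_le1 ?sqr1_gt0 // lerDl sqr_ge0.
have v1 x : `|v x| <= 1.
  rewrite /v normrM normfV (ger0_norm (ltW (sqr1_gt0 x))).
  rewrite ler_pdivrMr ?sqr1_gt0 // mul1r -[x ^+ 2]real_normK ?num_real //.
  by have := sqr_ge0 (`|x| - 1); rewrite sqrrB expr1n; have := normr_ge0 x; lra.
have M1 (a b c : R) : `|a| <= 1 -> `|b| <= 1 -> `|c| <= 1 -> `|a * b * c| <= 1.
  by move=> ha hb hc; rewrite !normrM !mulr_ile1 // mulr_ge0.
set P1 := u m; set P2 := v m; set Q1 := u (m + d); set Q2 := v (m + d).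
set T1 := u (m - d); set T2 := v (m - d).
(* The two brackets are the real and imaginary parts of the triple product of values of f. Each has
   four terms of modulus at most 1, whence the constant 8. *)
have -> : rho (m + d) + rho (m - d) - 2 * rho m =
   d ^+ 2 * (- 2 * (r0 * (P1 * Q1 * T1 - P1 * Q2 * T2 - P2 * Q1 * T2 - P2 * Q2 * T1)
    + r1 * (P1 * Q1 * T2 + P1 * Q2 * T1 + P2 * Q1 * T1 - P2 * Q2 * T2))).
  by rewrite /rho /P1 /P2 /Q1 /Q2 /T1 /T2 /u /v; field; rewrite ?n0.
rewrite [X in _ <= X]mulrC normrM ger0_norm ?sqr_ge0 //.
apply: ler_wpM2l; first exact: sqr_ge0.
rewrite normrM normrN (ger0_norm (_ : 0 <= 2)) //.
have H4 (a b c e : R) : `|a| <= 1 -> `|b| <= 1 -> `|c| <= 1 -> `|e| <= 1 ->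
    `|a + b + c + e| <= 4.
  move=> ha hb hc he; apply: (le_trans (ler_normD _ _)).
  have := ler_normD (a + b) c; have := ler_normD a b; lra.
have -> : 8 * (`|r0| + `|r1|) = 2 * (`|r0| * 4 + `|r1| * 4) by ring.
rewrite ler_pM2l //; apply: (le_trans (ler_normD _ _)).
rewrite !normrM; apply: lerD; apply: ler_wpM2l; rewrite ?normr_ge0 //;
  by apply: H4; rewrite ?normrN; apply: M1; first [exact: u1 | exact: v1].
Qed.

(** Division of the quartic numerator by 1 + a^2. The quotient has the nonnegative leading
    coefficient y_{s-1}^2, and the remainder is of the form covered by [second_difference_bound]. *)
Lemma penalty_decomposition {R : realType} (mu : R) (s : nat) (y : nat -> R) :
  exists k l r0 r1 : R, forall a, penalty mu s y a =
    y s.-1 ^+ 2 * a ^+ 2 + l * a + k + (r0 + r1 * a) / (1 + a ^+ 2).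
Proof.
set c2 := y s.-1; set c0 := y s.+1 - mu.
exists (mu ^+ 2 - 2 * c0 * c2 - c2 ^+ 2), (2 * mu * c2),
  (c0 ^+ 2 - (mu ^+ 2 - 2 * c0 * c2 - c2 ^+ 2)), (- 2 * c0 * mu - 2 * mu * c2) => a.
have n0 : 1 + a ^+ 2 != 0 by rewrite gt_eqF // sqr1_gt0.
by rewrite /penalty /c0 -/c2; field.
Qed.

(** Two minimizers m - d and m + d make the second difference of the profile at m nonpositive. It is
    at least (2 A + 2 y_{s-1}^2 - 8 (|r0| + |r1|)) d^2, which is positive for A > K unless d = 0. *)
Lemma profile_min_unique {R : realType} (mu : R) (s : nat) (y : nat -> R) :
  exists K : R, forall n, K < regA s n y -> forall a a',
    (forall x, profile mu s n y a <= profile mu s n y x) ->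
    (forall x, profile mu s n y a' <= profile mu s n y x) -> a' = a.
Proof.
have [k [l [r0 [r1 pE]]]] := penalty_decomposition mu s y.
exists (4 * (`|r0| + `|r1|)) => n KA a a' ma ma'.
apply/eqP; rewrite -subr_eq0; apply/eqP.
set m := (a + a') / 2; set d := (a' - a) / 2.
have aE : a = m - d by rewrite /m /d; field.
have a'E : a' = m + d by rewrite /m /d; field.
have h1 := ma m; have h2 := ma' m.
have sd := second_difference_bound r0 r1 m d.
have [d0|d0] := eqVneq d 0; first by rewrite aE a'E d0; ring.
have dd : 0 < d ^+ 2 by rewrite exprn_even_gt0.
have c0 := sqr_ge0 (y s.-1).
exfalso; move: sd; rewrite /= ler_norml => /andP[sd _].
move: h1 h2; rewrite /profile !pE aE a'E.
set A := regA s n y in KA *; set B := regB mu s n y.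
set F1 := _ / _ in sd *; set F2 := _ / _ in sd *; set F3 := _ / _ in sd *.
move=> h1 h2.
have : (2 * (A + y s.-1 ^+ 2) - 8 * (`|r0| + `|r1|)) * d ^+ 2 <= 0 by lra.
by apply/negP; rewrite -ltNge mulr_gt0 //; lra.
Qed.

Lemma Qn_has_unique_global_min {R : realType} (mu : R) (s : nat) (y : nat -> R) :
  (fun n => regA s n y) @ \oo --> +oo ->
  \forall n \near \oo, has_unique_global_min (Qn mu s n y).
Proof.
move=> Aoo; have [K uK] := profile_min_unique mu s y.
have A1 : \forall n \near \oo, 1 <= regA s n y by move/cvgryPge : Aoo; exact.
have A2 : \forall n \near \oo, K < regA s n y by move/cvgryPgt : Aoo; exact.
near=> n.
have [|a am] := @profile_has_min _ mu s n y; first by near: n.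
exists a, (outlier_hat mu s y a); split; first by apply/is_global_min_profile.
move=> a' t' /is_global_min_profile[a'm ->].
suff -> : a' = a by [].
by apply: (uK n) => //; near: n.
Unshelve. all: by end_near. Qed.

(** Comparing the profile at its minimizer with its value at [alpha], completing the square around
    B_n / A_n and dividing by A_n puts the minimizer close to B_n / A_n. The limit of the second
    coordinate follows by continuity of [outlier_hat]. *)
Lemma global_min_cvg {R : realType} (mu alpha : R) (s : nat) (y at_ tt_ : nat -> R) :
  (fun n => regA s n y) @ \oo --> +oo ->
  (fun n => regB mu s n y / regA s n y) @ \oo --> alpha ->
  (\forall n \near \oo, is_global_min (Qn mu s n y) (at_ n) (tt_ n)) ->
  at_ @ \oo --> alpha /\ tt_ @ \oo --> outlier_hat mu s y alpha.
Proof.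
move=> Aoo Balpha gm.
have A1 : \forall n \near \oo, 1 <= regA s n y by move/cvgryPge : Aoo; exact.
set b := fun n => regB mu s n y / regA s n y.
have invA : (fun n => (regA s n y)^-1) @ \oo --> 0 by apply/gtr0_cvgV0 => //;
  near=> n; rewrite (@lt_le_trans _ _ 1) //; near: n.
have key : \forall n \near \oo,
    (at_ n - b n) ^+ 2 <= (alpha - b n) ^+ 2 + penalty mu s y alpha * (regA s n y)^-1.
  near=> n.
  have An1 : 1 <= regA s n y by near: n.
  have An0 : 0 < regA s n y by lra.
  have /is_global_min_profile[/(_ alpha) + _] :
    is_global_min (Qn mu s n y) (at_ n) (tt_ n) by near: n.
  rewrite /profile.
  have := penalty_ge0 mu s y (at_ n).
  have -> : regB mu s n y = regA s n y * b n by rewrite /b mulrC divfK // gt_eqF.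
  move: An0; set A := regA s n y; set h := penalty _ _ _ _; set h' := penalty _ _ _ _.
  move=> A0 h0 hm.
  rewrite -(ler_pM2l A0) mulrDr (mulrC h') mulVKf ?gt_eqF //; lra.
have atc : at_ @ \oo --> alpha.
  have bd0 : (fun n => (alpha - b n) ^+ 2 + penalty mu s y alpha * (regA s n y)^-1)
     @ \oo --> 0.
    rewrite -[0]addr0; apply: cvgD.
      have : (fun n => alpha - b n) @ \oo --> alpha - alpha.
        by apply: cvgB => //; exact: cvg_cst.
      by rewrite subrr => /cvg_sqr; rewrite expr0n.
    by rewrite -[0](mulr0 (penalty mu s y alpha)); apply: cvgM => //; exact: cvg_cst.
  have sq0 : (fun n => (at_ n - b n) ^+ 2) @ \oo --> 0.
    apply: (@squeeze_cvgr _ _ _ _ (cst 0)) bd0; last exact: cvg_cst.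
    by near=> n; rewrite sqr_ge0 /=; near: n.
  have d0 : (fun n => at_ n - b n) @ \oo --> 0.
    apply/cvgr0Pnorm_lt => e e0.
    near=> n.
    have : `|(at_ n - b n) ^+ 2| < e ^+ 2.
      by near: n; apply: (cvgr0_norm_lt _ sq0); exact: exprn_gt0.
    by rewrite normrX ltr_pXn2r // nnegrE // ltW.
  have -> : at_ = (fun n => (at_ n - b n) + b n) by apply/funext => n; rewrite subrK.
  by rewrite -[alpha]add0r; apply: cvgD.
split=> //.
have tE : \forall n \near \oo, outlier_hat mu s y (at_ n) = tt_ n.
  near=> n.
  have /is_global_min_profile[_ ->//] :
    is_global_min (Qn mu s n y) (at_ n) (tt_ n) by near: n.
apply: (cvg_trans (near_eq_cvg tE)); rewrite /outlier_hat.
have iv : (fun n => (1 + at_ n ^+ 2)^-1) @ \oo --> (1 + alpha ^+ 2)^-1.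
  apply: cvgV; first by rewrite gt_eqF // sqr1_gt0.
  apply: cvgD; first exact: cvg_cst.
  exact: cvg_sqr.
apply: cvgB; first apply: cvgB; first exact: cvg_cst.
  by apply: cvgM; [exact: cvgM | exact: cvg_cst].
apply: cvgM; last exact: cvg_cst.
by apply: cvgM => //; apply: cvgB => //; exact: cvg_cst.
Unshelve. all: by end_near. Qed.

(** * Events generated by independent variables *)

Section Independence.
Context {d : measure_display} {T : measurableType d} {R : realType}.
Variable P : probability T R.
Context {I : eqType}.
Variable Z : I -> T -> nat.
Hypothesis mZ : forall i, measurable_fun setT (Z i).

Lemma measurable_preimage_nat (f : T -> nat) (B : set nat) :
  measurable_fun setT f -> measurable (f @^-1` B).
Proof. by move=> mf; rewrite -[_ @^-1` _]setTI; exact: mf. Qed.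

Lemma setI_fiber (A : set T) (f : T -> nat) :
  A = \bigcup_r (A `&` f @^-1` [set r]).
Proof.
apply/seteqP; split=> [w Aw|w [r _ []//]].
by exists (f w).
Qed.

Lemma trivIset_fiber (A : set T) (f : T -> nat) :
  trivIset setT (fun r => A `&` f @^-1` [set r]).
Proof.
apply/trivIsetP => i j _ _ ij; rewrite -subset0 => w [[_ /= wi] [_ /= wj]].
by move: ij; rewrite -wi -wj eqxx.
Qed.

(** Summation over the values of an integer variable; this takes the place of conditioning
    throughout. *)
Lemma integral_fiber (A : set T) (f : T -> nat) (g : T -> \bar R) :
  measurable A -> measurable_fun setT f -> measurable_fun setT g ->
  (forall w, 0 <= g w)%E ->
  (\int[P]_(w in A) g w = \sum_(r <oo) \int[P]_(w in A `&` f @^-1` [set r]) g w)%E.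
Proof.
move=> mA mf mg g0; rewrite [in LHS](setI_fiber A f) ge0_integral_bigcup //.
- by move=> r; apply: measurableI => //; exact: measurable_preimage_nat.
- exact: measurable_funTS.
- exact: trivIset_fiber.
Qed.

(* [A] behaves as an event generated by the variables with index in [J]. *)
Definition indep_outside (J : {pred I}) (A : set T) : Prop :=
  measurable A /\ forall (s : seq I) (B : I -> set nat), uniq s ->
    {in s, forall i, i \notin J} ->
    P (A `&` \bigcap_(i in [set` s]) (Z i @^-1` B i)) =
    (P A * \prod_(i <- s) P (Z i @^-1` B i))%E.

Lemma indep_outside_setT (J : {pred I}) :
  mutually_independent P Z -> indep_outside J setT.
Proof.
by move=> h; split=> // s B us _; rewrite setTI probability_setT mul1e; exact: h.
Qed.

Lemma indep_outside_widen (J J' : {pred I}) (A : set T) :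
  {subset J <= J'} -> indep_outside J A -> indep_outside J' A.
Proof.
move=> JJ' [mA hA]; split=> // s B us sJ; apply: hA => // i /sJ.
by apply: contra => /JJ'.
Qed.

Lemma indep_outside_prob (J : {pred I}) (A : set T) (i : I) (C : set nat) :
  i \notin J -> indep_outside J A ->
  P (A `&` Z i @^-1` C) = (P A * P (Z i @^-1` C))%E.
Proof.
move=> iJ [_ /(_ [:: i] (fun=> C) isT)].
rewrite big_seq1 set_cons1 bigcap_set1; apply.
by move=> j; rewrite inE => /eqP ->.
Qed.

Lemma indep_outside_setI (J : {pred I}) (A : set T) (i : I) (C : set nat) :
  i \notin J -> indep_outside J A ->
  indep_outside [predU1 i & J] (A `&` Z i @^-1` C).
Proof.
move=> iJ hA; have [mA iA] := hA; split=> [|s B us sJ].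
  by apply: measurableI => //; exact: measurable_preimage_nat.
have is' : i \notin s by apply/negP => /sJ; rewrite inE eqxx.
(* The independence of A is applied to i :: s, with the constraint at i overwritten by C; since i is
   not in s, the other constraints are unchanged. *)
pose B' j := if j == i then C else B j.
have B'B j : j \in s -> B' j = B j.
  by rewrite /B'; case: eqP => // ->; rewrite (negbTE is').
rewrite (indep_outside_prob C iJ hA) -muleA.
have B'i : B' i = C by rewrite /B' eqxx.
have := iA (i :: s) B'.
rewrite big_cons (eq_big_seq (fun j => P (Z j @^-1` B j))) /=; last first.
  by move=> j js /=; rewrite B'B.
rewrite is' us B'i => <- //; last first.
  move=> j; rewrite inE => /predU1P[->//|/sJ].
  by rewrite inE negb_or => /andP[].
congr (P _); rewrite -setIA; congr (A `&` _).
apply/seteqP; split=> [w [wC wB] j /= | w wB].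
  rewrite inE /B'; case: eqP => [->//|_ /= js]; exact: wB.
split; first by have := wB i; rewrite /B' /= eqxx inE eqxx; apply.
by move=> j /= js; rewrite -B'B //; apply: wB; rewrite /= inE js orbT.
Qed.

(** Both sides of the product formula are countably additive in the event. *)
Lemma indep_outside_bigcup (J : {pred I}) (F : nat -> set T) :
  trivIset setT F -> (forall r, indep_outside J (F r)) ->
  indep_outside J (\bigcup_r F r).
Proof.
move=> tF hF; have mF r : measurable (F r) by case: (hF r).
split=> [|s B us sJ]; first exact: bigcupT_measurable.
rewrite setI_bigcupl measure_semi_bigcup; last 3 first.
- move=> r; apply: measurableI => //.
  by apply: fin_bigcap_measurable => // i _; exact: measurable_preimage_nat.
- exact: trivIset_setIr.
- apply: bigcupT_measurable => r; apply: measurableI => //.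
  apply: fin_bigcap_measurable => // i _; exact: measurable_preimage_nat.
rewrite measure_semi_bigcup //; last exact: bigcupT_measurable.
have -> : (\prod_(i <- s) P (Z i @^-1` B i) =
    (fine (\prod_(i <- s) P (Z i @^-1` B i)))%:E)%E.
  rewrite fineK // prode_fin_num // => i _; apply: fin_num_measure.
  exact: measurable_preimage_nat.
rewrite muleC -nneseriesZl; last by move=> r _; exact: measure_ge0.
apply: eq_eseriesr => r _ /=; have [_ ->] // := hF r; rewrite muleC; congr (_ * _)%E.
rewrite fineK // prode_fin_num // => i _; apply: fin_num_measure.
exact: measurable_preimage_nat.
Qed.

(** Induction on the list: on the fiber where the first variable equals c, the others must sum to r
    - c, and the fiber is empty if c > r. *)
Lemma indep_outside_sum (l : seq I) (J : {pred I}) (A : set T) (r : nat) :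
  uniq l -> {in l, forall i, i \notin J} -> indep_outside J A ->
  indep_outside [predU l & J] (A `&` [set w | (\sum_(i <- l) Z i w)%N = r]).
Proof.
elim: l J A r => [|i l IH] J A r /=.
  move=> _ _ hA.
  have [<-|r0] := eqVneq 0%N r.
    have -> : [set w : T | (\sum_(i <- [::]) Z i w)%N = 0%N] = setT.
      by apply/seteqP; split=> // w _ /=; rewrite big_nil.
    by rewrite setIT; apply: indep_outside_widen hA => i iJ; rewrite inE iJ orbT.
  have -> : [set w : T | (\sum_(i <- [::]) Z i w)%N = r] = set0.
    by apply/seteqP; split=> // w /=; rewrite big_nil => /eqP; rewrite (negbTE r0).
  by rewrite setI0; split=> // s B _ _; rewrite set0I measure0 mul0e.
move=> /andP[il ul] lJ hA.
rewrite (setI_fiber (_ `&` _) (Z i)); apply: indep_outside_bigcup; first exact: trivIset_fiber.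
move=> c.
have iJ : i \notin J by apply: lJ; rewrite mem_head.
have hA' := indep_outside_setI [set c] iJ hA.
have lJ' : {in l, forall j, j \notin [predU1 i & J]}.
  move=> j jl; rewrite inE negb_or lJ ?inE ?jl ?orbT // andbT.
  by apply: contraNneq il => <-.
have [cr|rc] := leqP c r.
  have := IH _ _ (r - c)%N ul lJ' hA'.
  move=> /(@indep_outside_widen _ [predU i :: l & J])-/(_ _)/wrap[].
    by move=> j; rewrite !inE => /or3P[->|->|->]; rewrite ?orbT.
  congr indep_outside; apply/seteqP; split=> w /=.
    by move=> [[Aw wc] wr]; rewrite big_cons wr wc subnKC.
  by move=> [[Aw]]; rewrite big_cons => <- <-; rewrite addKn.
have -> : A `&` [set w | (\sum_(j <- i :: l) Z j w)%N = r] `&` Z i @^-1` [set c] = set0.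
  rewrite -subset0 => w /= [[_]]; rewrite big_cons => h wc.
  by move: rc; rewrite -h wc ltnNge leq_addr.
by split=> // s B _ _; rewrite set0I measure0 mul0e.
Qed.

Lemma indep_outside_integral (J : {pred I}) (A : set T) (i : I) (phi : nat -> \bar R) :
  i \notin J -> indep_outside J A -> (forall r, 0 <= phi r)%E ->
  (\int[P]_(w in A) phi (Z i w) = P A * \int[P]_w phi (Z i w))%E.
Proof.
move=> iJ hA phi0; have [mA _] := hA.
have mphi : measurable_fun setT (fun w => phi (Z i w)).
  by apply: (measurableT_comp _ (mZ i)).
have cst B r : measurable B ->
    (\int[P]_(w in B `&` Z i @^-1` [set r]) phi (Z i w) = phi r * P (B `&` Z i @^-1` [set r]))%E.
  move=> mB; rewrite -integral_cst; last first.
    by apply: measurableI => //; exact: measurable_preimage_nat.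
  by apply: eq_integral => w; rewrite inE => -[_ /= ->].
rewrite (integral_fiber _ (mZ i)) // (integral_fiber _ (mZ i)) //.
rewrite -(fineK (fin_num_measure P _ mA)).
rewrite -nneseriesZl //; last by move=> r _; exact: integral_ge0.
apply: eq_eseriesr => r _; rewrite fineK ?fin_num_measure //.
by rewrite !cst // (indep_outside_prob [set r] iJ hA) setTI muleCA.
Qed.

(* Stated through all the squares of affine functions of [f], so that only
   nonnegative integrals occur. *)
Definition mean_var (f : T -> nat) (m v : R) : Prop := 0 <= v /\ forall c a : R,
  (\int[P]_w ((c + a * ((f w)%:R - m)) ^+ 2)%:E = (c ^+ 2 + a ^+ 2 * v)%:E)%E.

(** Conditional second moment of an affine function of a sum of independent centered variables. The
    shift c and the event A are general because, on a fiber of the first variable, its term is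
    absorbed into c and the fiber into A. *)
Lemma integral_sqr_sum (l : seq I) (m v : I -> R) (J : {pred I}) (A : set T) (c a : R) :
  uniq l -> {in l, forall i, i \notin J} -> {in l, forall i, mean_var (Z i) (m i) (v i)} ->
  indep_outside J A ->
  (\int[P]_(w in A) ((c + a * \sum_(i <- l) ((Z i w)%:R - m i)) ^+ 2)%:E =
   P A * (c ^+ 2 + a ^+ 2 * \sum_(i <- l) v i)%:E)%E.
Proof.
have mZR i : measurable_fun setT (fun w => (Z i w)%:R : R).
  by apply: (measurableT_comp (f := fun n : nat => n%:R : R) _ (mZ i)).
elim: l J A c => [|i l IH] J A c /=.
  move=> _ _ _ [mA _]; rewrite big_nil !mulr0 !addr0.
  under eq_integral do rewrite big_nil mulr0 addr0.
  by rewrite integral_cst // muleC.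
move=> /andP[il ul] lJ mv hA; have [mA _] := hA.
have iJ : i \notin J by apply: lJ; rewrite mem_head.
have lJ' : {in l, forall j, j \notin [predU1 i & J]}.
  move=> j jl; rewrite inE negb_or lJ ?inE ?jl ?orbT // andbT.
  by apply: contraNneq il => <-.
have mv' : {in l, forall j, mean_var (Z j) (m j) (v j)}.
  by move=> j jl; apply: mv; rewrite inE jl orbT.
have [vi0 mvi] : mean_var (Z i) (m i) (v i) by apply: mv; rewrite mem_head.
set V := \sum_(j <- l) v j.
have V0 : 0 <= V by rewrite /V big_seq sumr_ge0 // => j /mv'[].
(* What the induction hypothesis yields on the fiber [Z i] = r, up to the probability of that
   fiber. *)
pose phi (r : nat) : \bar R := ((c + a * (r%:R - m i)) ^+ 2 + a ^+ 2 * V)%:E.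
have phi0 r : (0 <= phi r)%E.
  by rewrite lee_fin addr_ge0 ?sqr_ge0 // mulr_ge0 ?sqr_ge0.
transitivity (\int[P]_(w in A) phi (Z i w))%E.
  rewrite (integral_fiber _ (mZ i)) //; last 2 first.
  - apply/measurable_EFinP; apply: measurable_funX; apply: measurable_funD => //.
    apply: measurable_funM => //; apply: measurable_sum => j.
    exact: measurable_funB.
  - by move=> w; rewrite lee_fin sqr_ge0.
  rewrite [RHS](integral_fiber _ (mZ i)) //; last by apply: (measurableT_comp _ (mZ i)).
  apply: eq_eseriesr => r _.
  have := indep_outside_setI [set r] iJ hA => hA'.
  have [mA' _] := hA'.
  transitivity (\int[P]_(w in A `&` Z i @^-1` [set r])
     ((c + a * (r%:R - m i) + a * \sum_(j <- l) ((Z j w)%:R - m j)) ^+ 2)%:E)%E.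
    apply: eq_integral => w; rewrite inE big_cons => -[_ /= ->].
    by rewrite mulrDr addrA.
  rewrite (IH _ _ _ ul lJ' mv' hA') muleC -integral_cst //.
  by apply: eq_integral => w; rewrite inE => -[_ /= ->].
rewrite (indep_outside_integral iJ hA phi0) /phi; congr (_ * _)%E.
under eq_integral do rewrite EFinD.
rewrite ge0_integralD //; last 3 first.
- by move=> w _; rewrite lee_fin sqr_ge0.
- apply/measurable_EFinP; apply: measurable_funX; apply: measurable_funD => //.
  by apply: measurable_funM => //; exact: measurable_funB.
- by move=> w _; rewrite lee_fin mulr_ge0 ?sqr_ge0.
rewrite mvi integral_cst //= probability_setT mule1 -EFinD big_cons -/V.
by congr EFin; ring.
Qed.

End Independence.

(** * The stopped noise *)

(** The b_n of the overview. The term 1 keeps it invertible, and b_{n+1} involves only u_0, ...,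
    u_n, so it is known at time n. *)
Definition energy {R : realType} (u : nat -> nat) (n : nat) : R :=
  1 + \sum_(0 <= k < n) (u k)%:R ^+ 2.

(** Index k stands for M_{k+1}, the increment from time k to time k + 1. *)
Definition innovation {R : realType} (alpha mu : R) (u : nat -> nat) (k : nat) : R :=
  (u k.+1)%:R - alpha * (u k)%:R - mu.

(* The normalized noise [\sum_(N <= k < n) u k * innovation k / energy n],
   frozen as soon as its modulus reaches [e]. *)
Fixpoint stopped_noise {R : realType} (alpha mu e : R) (N : nat) (u : nat -> nat)
    (n : nat) : R :=
  if n is n'.+1 then
    if (n' < N)%N then 0 else
    let W := stopped_noise alpha mu e N u n' in
    if e <= `|W| then W
    else (energy u n' * W + (u n')%:R * innovation alpha mu u n') / energy u n
  else 0.

(** * Pathwise properties of the noise and the energy *)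

Section Deterministic.
Context {R : realType}.
Implicit Types (u : nat -> nat) (alpha mu e : R).

Lemma energy_ge1 u n : 1 <= energy u n :> R.
Proof. by rewrite /energy lerDl sumr_ge0 // => k _; rewrite sqr_ge0. Qed.

Lemma energyS u n : energy u n.+1 = energy u n + (u n)%:R ^+ 2 :> R.
Proof. by rewrite /energy big_nat_recr //= addrA. Qed.

Lemma eq_energy u u' n : (forall k, (k < n)%N -> u k = u' k) ->
  energy u n = energy u' n :> R.
Proof.
move=> h; rewrite /energy; congr (_ + _); apply: eq_big_nat => k /andP[_ kn].
by rewrite h.
Qed.

Lemma eq_stopped_noise alpha mu e N u u' n :
  (forall k, (k <= n)%N -> u k = u' k) ->
  stopped_noise alpha mu e N u n = stopped_noise alpha mu e N u' n.
Proof.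
elim: n => [//|n IH] h; rewrite /= IH; last by move=> k kn; apply: h; exact: leqW.
have -> : innovation alpha mu u n = innovation alpha mu u' n.
  by rewrite /innovation !h.
rewrite (@eq_energy u u' n) ?(@eq_energy u u' n.+1) ?h //.
by move=> k kn; apply: h; rewrite ltnW.
by move=> k kn; apply: h; exact: leqW (ltnW kn).
Qed.

Lemma stopped_noise_start alpha mu e N u n : (n <= N)%N ->
  stopped_noise alpha mu e N u n = 0.
Proof. by case: n => [//|n] nN /=; rewrite nN. Qed.

Lemma stopped_noise_frozen alpha mu e N u n : 0 < e ->
  e <= `|stopped_noise alpha mu e N u n| ->
  stopped_noise alpha mu e N u n.+1 = stopped_noise alpha mu e N u n.
Proof.
move=> e0 eW; rewrite /=; case: ifPn => [nN|_]; last by rewrite eW.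
by rewrite stopped_noise_start // ltnW.
Qed.

Lemma stopped_noise_free alpha mu e N u n :
  (forall k, `|stopped_noise alpha mu e N u k| < e) -> (N <= n)%N ->
  energy u n * stopped_noise alpha mu e N u n =
  \sum_(N <= k < n) (u k)%:R * innovation alpha mu u k.
Proof.
move=> We; elim: n => [|n IH].
  by rewrite leqn0 => /eqP ->; rewrite /= mulr0 big_geq.
rewrite leq_eqVlt => /predU1P[->|nN].
  by rewrite stopped_noise_start // mulr0 big_geq.
rewrite big_nat_recr //= -(IH nN) ltnNge -ltnS nN /= leNgt We /=.
by rewrite mulrC divfK // gt_eqF // (lt_le_trans ltr01 (energy_ge1 _ _)).
Qed.

(* Writing [b = p ^+ 2] and [b + m ^+ 2 = q ^+ 2], the claim reduces to
   [m ^+ 2 * (m + 1) <= 2 * (q ^+ 2 - p ^+ 2) * q] and [(q + p) * p <= 2 * q ^+ 2]. *)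
Lemma potential_step (b W s C : R) (m : nat) :
  1 <= b -> 0 <= C -> s <= C * (m%:R + 1) ->
  (b * W / (b + m%:R ^+ 2)) ^+ 2 + (m%:R / (b + m%:R ^+ 2)) ^+ 2 * s
    + 4 * C / Num.sqrt (b + m%:R ^+ 2)
  <= W ^+ 2 + 4 * C / Num.sqrt b.
Proof.
move=> b1 C0 sC; set M : R := m%:R in sC *.
have b0 : 0 <= b by lra.
have M0 : 0 <= M by rewrite /M.
have b'0 : 0 <= b + M ^+ 2 by rewrite addr_ge0 // sqr_ge0.
set p := Num.sqrt b; set q := Num.sqrt (b + M ^+ 2).
have pE : b = p ^+ 2 by rewrite sqr_sqrtr.
have qE : b + M ^+ 2 = q ^+ 2 by rewrite sqr_sqrtr.
have p1 : 1 <= p by rewrite -[1](@sqrtr1 R) ler_sqrt.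
have pq : p <= q by rewrite ler_sqrt // lerDl sqr_ge0.
have Mq : M <= q.
  by rewrite -(@ler_pXn2r _ 2) // ?nnegrE ?sqrtr_ge0 // -qE lerDr.
have q0 : 0 < q by lra.
have p0 : 0 < p by lra.
rewrite qE.
have h1 : (b * W / q ^+ 2) ^+ 2 <= W ^+ 2.
  rewrite mulrAC exprMn ler_piMl ?sqr_ge0 // -qE exprn_ile1 //.
    by rewrite divr_ge0.
  by rewrite ler_pdivrMr ?mul1r ?lerDl ?sqr_ge0 // qE exprn_gt0.
(* Here [m] being an integer matters: it is 0, or M >= 1 and then M + 1 <= 2 M <= 2 q. *)
have MM : M ^+ 2 * (M + 1) <= 2 * (q ^+ 2 - p ^+ 2) * q.
  have -> : q ^+ 2 - p ^+ 2 = M ^+ 2 by rewrite -qE -pE addrC addKr.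
  have [m0|m0] := posnP m; first by rewrite /M m0 expr0n /= !mul0r mulr0 mul0r.
  have M1 : 1 <= M by rewrite /M ler1n.
  have -> : 2 * M ^+ 2 * q = M ^+ 2 * (2 * q) by ring.
  by rewrite ler_wpM2l ?sqr_ge0 //; lra.
have h2 : (M / q ^+ 2) ^+ 2 * s <= C * (2 * (q ^+ 2 - p ^+ 2) / q ^+ 3).
  apply: (@le_trans _ _ ((M / q ^+ 2) ^+ 2 * (C * (M + 1)))).
    by rewrite ler_wpM2l ?sqr_ge0.
  have -> : (M / q ^+ 2) ^+ 2 * (C * (M + 1)) = C * (M ^+ 2 * (M + 1) / q ^+ 4).
    by field; rewrite gt_eqF.
  rewrite ler_wpM2l // ler_pdivrMr ?exprn_gt0 //.
  by have -> : 2 * (q ^+ 2 - p ^+ 2) / q ^+ 3 * q ^+ 4 = 2 * (q ^+ 2 - p ^+ 2) * q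
    by field; rewrite gt_eqF.
have h3 : 2 * (q ^+ 2 - p ^+ 2) / q ^+ 3 <= 4 / p - 4 / q.
  rewrite -subr_ge0.
  have -> : 4 / p - 4 / q - 2 * (q ^+ 2 - p ^+ 2) / q ^+ 3 =
    2 * (q - p) * (2 * q ^+ 2 - (q + p) * p) / (p * q ^+ 3).
    by field; rewrite !gt_eqF.
  rewrite divr_ge0 // ?mulr_ge0 ?exprn_ge0 //; try lra.
  have : p * p <= q * p by rewrite ler_wpM2r //; lra.
  have : p * q <= q * q by rewrite ler_wpM2r //; lra.
  by rewrite expr2; lra.
have := ler_wpM2l C0 h3; move: h1 h2; lra.
Qed.

Lemma energy_cvgy u :
  (forall m, exists2 k, (m <= k)%N & (0 < u k)%N) ->
  (fun n => energy u n : R) @ \oo --> +oo.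
Proof.
move=> uoo; have nde : {homo (fun n => energy u n : R) : n m / (n <= m)%N >-> n <= m}.
  by apply: homo_leq => [//|x y z|n]; [exact: le_trans | rewrite energyS lerDl sqr_ge0].
have eM (M : nat) : exists n, M%:R <= energy u n :> R.
  elim: M => [|M [n Mn]]; first by exists 0; rewrite (le_trans ler01) // energy_ge1.
  have [k nk uk] := uoo n; exists k.+1.
  rewrite energyS -natr1 lerD //; first exact: (le_trans Mn (nde _ _ nk)).
  by rewrite -natrX ler1n expn_gt0 uk.
apply/cvgryPge => A; have [n nA] := eM (Num.trunc `|A|).+1.
near=> m; apply: (le_trans (ler_norm A)); apply: (@le_trans _ _ (energy u n)).
  by apply: (le_trans _ nA); rewrite ltW // truncnS_gt.
by apply: nde; near: m; exact: nbhs_infty_ge.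
Unshelve. all: by end_near. Qed.

(** The sum is cut at N: the head is a fixed number divided by a diverging energy, the tail is small
    by assumption. Tolerances 1 / (j + 1) are used so that only countably many almost sure
    statements will have to be intersected. *)
Lemma noise_cvg0 alpha mu u :
  (fun n => energy u n : R) @ \oo --> +oo ->
  (forall j : nat, exists N, forall n, (N <= n)%N ->
     `|\sum_(N <= k < n) (u k)%:R * innovation alpha mu u k| <= j.+1%:R^-1 * energy u n) ->
  (fun n => (\sum_(0 <= k < n) (u k)%:R * innovation alpha mu u k) / energy u n)
    @ \oo --> (0 : R).
Proof.
move=> Eoo small; apply/cvgr0Pnorm_le => e e0.
pose j := Num.trunc (2 / e); have [N hN] := small j.
set Z := fun n => \sum_(0 <= k < n) (u k)%:R * innovation alpha mu u k.
have je : j.+1%:R^-1 <= e / 2.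
  rewrite -[e / 2]invrK lef_pV2 ?posrE ?invr_gt0 ?divr_gt0 //.
  by rewrite invf_div ltW // truncnS_gt.
near=> n.
have Nn : (N <= n)%N by near: n; exact: nbhs_infty_ge.
have En : 0 < energy u n :> R by rewrite (lt_le_trans ltr01) // energy_ge1.
rewrite normrM normfV (ger0_norm (ltW En)) ler_pdivrMr //.
rewrite (big_cat_nat (leq0n N) Nn) //=; apply: (le_trans (ler_normD _ _)).
have h1 := hN n Nn.
have h2 : j.+1%:R^-1 * energy u n <= e / 2 * energy u n by rewrite ler_wpM2r // ltW.
have h3 : `|Z N| <= e / 2 * energy u n.
  rewrite mulrC -ler_pdivrMr ?divr_gt0 //; near: n.
  by move/cvgryPge : Eoo; exact.
by apply: (le_trans (lerD h3 (le_trans h1 h2))); rewrite -mulrDl -splitr.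
Unshelve. all: by end_near. Qed.

End Deterministic.

(** * Square integrable variables *)

Section SquareIntegrable.
Context {d : measure_display} {T : measurableType d} {R : realType}.
Variable P : probability T R.

Lemma integral_prob_cst (c : R) : (\int[P]_w c%:E = c%:E)%E.
Proof. by rewrite integral_cst //= probability_setT mule1. Qed.

Lemma eq_distribution_integral (f g : T -> nat) (phi : nat -> \bar R) :
  measurable_fun setT f -> measurable_fun setT g ->
  (forall B, P (f @^-1` B) = P (g @^-1` B)) -> (forall r, 0 <= phi r)%E ->
  (\int[P]_w phi (f w) = \int[P]_w phi (g w))%E.
Proof.
move=> mf mg fg phi0.
have cst h r : measurable_fun setT h ->
    (\int[P]_(w in setT `&` h @^-1` [set r]) phi (h w) = phi r * P (h @^-1` [set r]))%E.
  move=> mh; rewrite -integral_cst; last by exact: measurable_preimage_nat.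
  by rewrite setTI; apply: eq_integral => w; rewrite inE /= => ->.
rewrite (integral_fiber P _ mf) //; last by apply: (measurableT_comp _ mf).
rewrite (integral_fiber P _ mg) //; last by apply: (measurableT_comp _ mg).
by apply: eq_eseriesr => r _; rewrite !cst // fg.
Qed.

Variable f : T -> nat.
Hypothesis mf : measurable_fun setT f.

Let mfR : measurable_fun setT (fun w => (f w)%:R : R).
Proof. by apply: (measurableT_comp (f := fun n : nat => n%:R : R) _ mf). Qed.

Lemma integrable_nat_sqr :
  P.-integrable setT (fun w => ((f w)%:R ^+ 2 : R)%:E) ->
  P.-integrable setT (fun w => ((f w)%:R : R)%:E).
Proof.
move=> h; apply: (le_integrable _ _ _ h) => //; first exact/measurable_EFinP.
move=> w _ /=; rewrite lee_fin !ger0_norm ?sqr_ge0 // expr2 -natrM ler_nat.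
by case: (f w) => // n; rewrite leq_pmull.
Qed.

(** The square is expanded and the cross term integrates to 0. *)
Lemma mean_var_sqr_integrable :
  P.-integrable setT (fun w => ((f w)%:R ^+ 2 : R)%:E) ->
  let m := fine (\int[P]_w ((f w)%:R : R)%:E)%E in
  mean_var P f m (fine (\int[P]_w (((f w)%:R - m) ^+ 2)%:E)%E).
Proof.
move=> i2 m; have i1 := integrable_nat_sqr i2.
have mE : (\int[P]_w ((f w)%:R : R)%:E = m%:E)%E.
  by rewrite fineK // integrable_fin_num.
have ic (c : R) : P.-integrable setT (EFin \o cst c).
  exact: finite_measure_integrable_cst.
have ib : P.-integrable setT (EFin \o (fun w => (f w)%:R - m)).
  by have := integrableB measurableT i1 (ic m); apply: eq_integrable.
have ib2 : P.-integrable setT (EFin \o (fun w => ((f w)%:R - m) ^+ 2)).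
  (* The bound (f - m)^2 <= 2 f^2 + 2 m^2, with difference (f + m)^2. *)
  have ig : P.-integrable setT (EFin \o (fun w => 2 * (f w)%:R ^+ 2 + 2 * m ^+ 2)).
    have := integrableD measurableT (integrableZl measurableT 2 i2) (ic (2 * m ^+ 2)).
    by apply: eq_integrable.
  apply: (le_integrable _ _ _ ig) => //.
    by apply/measurable_EFinP; apply: measurable_funX; exact: measurable_funB.
  move=> w _ /=; rewrite lee_fin ger0_norm ?sqr_ge0 // ger0_norm; last first.
    by rewrite addr_ge0 // mulr_ge0 // sqr_ge0.
  rewrite -subr_ge0.
  have -> : 2 * (f w)%:R ^+ 2 + 2 * m ^+ 2 - ((f w)%:R - m) ^+ 2 = ((f w)%:R + m) ^+ 2 by ring.
  exact: sqr_ge0.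
have b0 : (\int[P]_w ((f w)%:R - m)%:E = 0)%E.
  rewrite (_ : (fun w => _) = (fun w => ((f w)%:R%:E - (cst m w)%:E)%E)); last first.
    by apply/funext.
  rewrite (integralB_EFin measurableT i1 (ic m)).
  rewrite mE; have -> : (\int[P]_w (cst m w)%:E = m%:E)%E.
    exact: integral_prob_cst.
  by rewrite -EFinB subrr.
split; first by rewrite fine_ge0 // integral_ge0 // => w _; rewrite lee_fin sqr_ge0.
move=> c a; set v := fine _.
have vE : (\int[P]_w (((f w)%:R - m) ^+ 2)%:E = v%:E)%E.
  by rewrite fineK // integrable_fin_num.
pose g1 w : R := 2 * c * a * ((f w)%:R - m).
pose g2 w : R := a ^+ 2 * ((f w)%:R - m) ^+ 2.
pose g3 w : R := c ^+ 2 + g1 w.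
have i1' : P.-integrable setT (EFin \o g1).
  by have := integrableZl measurableT (2 * c * a) ib; apply: eq_integrable.
have i2' : P.-integrable setT (EFin \o g2).
  by have := integrableZl measurableT (a ^+ 2) ib2; apply: eq_integrable.
have i3 : P.-integrable setT (EFin \o g3).
  by have := integrableD measurableT (ic (c ^+ 2)) i1'; apply: eq_integrable.
have E1 : (\int[P]_w (g1 w)%:E = 0)%E.
  transitivity ((2 * c * a)%R%:E * \int[P]_w ((f w)%:R - m)%:E)%E; last by rewrite b0 mule0.
  by rewrite -integralZl.
have E2 : (\int[P]_w (g2 w)%:E = (a ^+ 2 * v)%:E)%E.
  by rewrite EFinM -vE -integralZl.
have E3 : (\int[P]_w (g3 w)%:E = (c ^+ 2)%:E)%E.
  transitivity (\int[P]_w ((EFin \o cst (c ^+ 2)%R) \+ (EFin \o g1)) w)%E.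
    by apply: eq_integral => w _; rewrite /= -EFinD.
  rewrite (integralD_EFin measurableT (ic (c ^+ 2)) i1').
  rewrite (_ : (\int[P]_w (EFin \o g1) w) = 0)%E // adde0.
  exact: integral_prob_cst.
transitivity (\int[P]_w ((EFin \o g3) \+ (EFin \o g2)) w)%E.
  by apply: eq_integral => w _; rewrite /= -EFinD /g3 /g2 /g1; congr EFin; ring.
rewrite (integralD_EFin measurableT i3 i2').
by rewrite (_ : (\int[P]_w (EFin \o g3) w) = (c ^+ 2)%:E)%E // E2 EFinD.
Qed.

End SquareIntegrable.

(** * The INAR(1) process *)

(** The time at which a primitive variable enters the recursion; X_0, ..., X_n depend on stages up
    to n only. *)
Definition stage (i : unit + (nat + nat * nat)) : nat :=
  match i with
  | inl _ => 0
  | inr (inl k) => k.+1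
  | inr (inr (k, _)) => k.+1
  end.

(** The variables consumed in passing from X_n = m to X_{n+1}. *)
Definition step_indices (n m : nat) : seq (unit + (nat + nat * nat)) :=
  inr (inl n) :: [seq inr (inr (n, j)) | j <- iota 0 m].

Lemma step_indices_uniq n m : uniq (step_indices n m).
Proof.
rewrite /= map_inj_uniq ?iota_uniq ?andbT; last by move=> i j [].
by apply/mapP => -[].
Qed.

Lemma step_indices_stage n m : {in step_indices n m, forall i, stage i = n.+1}.
Proof. by move=> i; rewrite inE => /predU1P[->//|/mapP[j _ ->]]. Qed.

Section Inar.
Context {d : measure_display} {T : measurableType d} {R : realType}.
Variable P : probability T R.
Variables (alpha : R) (X0 : T -> nat) (eps : nat -> T -> nat) (xi : nat -> nat -> T -> nat).
Hypothesis mX0 : measurable_fun setT X0.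
Hypothesis meps : forall k, measurable_fun setT (eps k).
Hypothesis mxi : forall k j, measurable_fun setT (xi k j).
Let Z := inar_family X0 eps xi.
Let X := inarX X0 eps xi.
Hypothesis indepZ : mutually_independent P Z.

Lemma measurable_inar_family i : measurable_fun setT (Z i).
Proof. by case: i => [u|[k|[k j]]]; [exact: mX0 | exact: meps | exact: mxi]. Qed.

Lemma inarX_step n w : X n.+1 w = (\sum_(i <- step_indices n (X n w)) Z i w)%N.
Proof.
rewrite big_cons big_map /= addnC; congr (_ + _)%N.
by rewrite -[X in iota 0 X]subn0 big_mkord.
Qed.

(** The atoms of the sigma-algebra generated by X_0, ..., X_n. There are countably many, and
    integrals over them replace conditional expectations given the past. *)
Definition atom (n : nat) (w0 : T) : set T :=
  [set w | forall k, (k <= n)%N -> X k w = X k w0].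

Lemma atomS n w0 : atom n.+1 w0 = atom n w0 `&`
  [set w | (\sum_(i <- step_indices n (X n w0)) Z i w)%N = X n.+1 w0].
Proof.
apply/seteqP; split=> w /=.
  move=> h; split=> [k kn|]; first by apply: h; exact: leqW.
  by rewrite -(h n) // -(h n.+1) // inarX_step.
move=> [h hn] k; rewrite leq_eqVlt => /predU1P[->|]; last exact: h.
by rewrite inarX_step (h n).
Qed.

(** On an atom of time n the number of summands in X_{n+1} is frozen, so passing to time n + 1 only
    prescribes a sum over a fixed list of variables of stage n + 1. *)
Lemma indep_outside_atom n w0 :
  indep_outside P Z [pred i | (stage i <= n)%N] (atom n w0).
Proof.
elim: n => [|n IH].
  have -> : atom 0 w0 = setT `&` Z (inl tt) @^-1` [set X0 w0].
    rewrite setTI; apply/seteqP; split=> w /=; first by move=> /(_ 0 isT).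
    by move=> h k; rewrite leqn0 => /eqP ->.
  have := indep_outside_setI measurable_inar_family [set X0 w0] (isT : inl tt \notin pred0)
    (indep_outside_setT pred0 indepZ).
  by apply: indep_outside_widen => i; rewrite !inE ?orbF => /eqP ->.
rewrite atomS.
apply: indep_outside_widen (indep_outside_sum measurable_inar_family _
  (step_indices_uniq n (X n w0)) _ IH).
  move=> i; rewrite !inE => /orP[/step_indices_stage ->|] //.
  by move=> /leqW.
by move=> i /step_indices_stage; rewrite inE => ->; rewrite ltnn.
Qed.

Lemma measurable_atom n w0 : measurable (atom n w0).
Proof. by have [] := indep_outside_atom n w0. Qed.

Definition history (n : nat) (w : T) : seq nat := mkseq (X ^~ w) n.+1.

Lemma history_atom n w w0 : history n w = history n w0 <-> atom n w0 w.
Proof.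
split=> [h k kn|h].
  by have := congr1 (nth 0%N ^~ k) h; rewrite !nth_mkseq.
by apply/eq_in_map => k; rewrite mem_iota /= add0n ltnS => kn; exact: h.
Qed.

(** A function constant on atoms has preimages that are countable unions of atoms, since histories
    are finite sequences of integers. *)
Lemma measurable_adapted {d'} {U : measurableType d'} n (phi : T -> U) :
  (forall w w0, atom n w0 w -> phi w = phi w0) -> measurable_fun setT phi.
Proof.
move=> ad _ Y mY; rewrite setTI.
have -> : phi @^-1` Y = \bigcup_(x : seq nat) [set w | history n w = x /\ Y (phi w)].
  apply/seteqP; split=> [w Yw|w [x _ []//]]; by exists (history n w).
apply: countable_bigcupT_measurable; [exact: countableP | move=> x].
have [[w0 [<- Yw0]]|none] := pselect (exists w0, history n w0 = x /\ Y (phi w0)).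
  have -> : [set w | history n w = history n w0 /\ Y (phi w)] = atom n w0.
    apply/seteqP; split=> [w [/history_atom //]|w hw].
    by split; [exact/history_atom | rewrite (ad _ _ hw)].
  exact: measurable_atom.
rewrite (_ : [set w | _] = set0) //; rewrite -subset0 => w hw.
by apply: none; exists w.
Qed.

Variables (mean var : unit + (nat + nat * nat) -> R) (C mu : R).
Hypothesis mvZ : forall i, (0 < stage i)%N -> mean_var P (Z i) (mean i) (var i).
Hypothesis mean_eps : forall k, mean (inr (inl k)) = mu.
Hypothesis mean_xi : forall k j, mean (inr (inr (k, j))) = alpha.
Hypothesis varC : forall i, (0 < stage i)%N -> var i <= C.

(** Given X_n = m, the term alpha m + mu subtracted in the innovation is the sum of the means of the
    m thinning variables and the immigration. *)
Lemma innovation_step n w w0 : atom n w0 w ->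
  innovation alpha mu (X ^~ w) n =
  \sum_(i <- step_indices n (X n w0)) ((Z i w)%:R - mean i).
Proof.
move=> h; transitivity ((X n.+1 w)%:R - alpha * (X n w0)%:R - mu).
  by rewrite /innovation (h n).
rewrite inarX_step (h n) // sumrB natr_sum -addrA; congr (_ + _).
rewrite big_cons big_map mean_eps.
under eq_bigr do rewrite mean_xi.
rewrite big_const_seq count_predT size_iota iter_addr_0 mulr_natr.
by rewrite opprD addrC.
Qed.

(** * The supermartingale and its maximal inequality *)

Section Stopping.
Variables (e : R) (N : nat).
Hypothesis e0 : 0 < e.

Let W n w : R := stopped_noise alpha mu e N (X ^~ w) n.
Let b n w : R := energy (X ^~ w) n.

(** The process W_n^2 + K b_n^{-1/2} of the overview, with K = 4 C. *)
Definition potential n w : R := W n w ^+ 2 + 4 * C / Num.sqrt (b n w).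

Lemma var_bound_ge0 : 0 <= C.
Proof.
by have [v0 _] := @mvZ (inr (inl 0%N)) isT; apply: (le_trans v0); exact: varC.
Qed.

Lemma potential_adapted n w w0 : atom n w0 w -> potential n w = potential n w0.
Proof.
move=> h; rewrite /potential /W /b (eq_stopped_noise _ _ _ _ h).
by rewrite (@eq_energy _ _ (X ^~ w0)) // => k kn; apply: h; exact: ltnW.
Qed.

Lemma potential_ge0 n w : 0 <= potential n w.
Proof.
by rewrite addr_ge0 ?sqr_ge0 // divr_ge0 ?sqrtr_ge0 // mulr_ge0 // var_bound_ge0.
Qed.

Lemma measurable_potential n : measurable_fun setT (potential n).
Proof. by apply: (@measurable_adapted _ _ n) => w w0; exact: potential_adapted. Qed.

Lemma energy_adapted n w w0 : atom n w0 w -> b n.+1 w = b n.+1 w0.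
Proof. by move=> h; apply: eq_energy => k kn; exact: h. Qed.

Lemma sqrt_energy_step n w :
  4 * C / Num.sqrt (b n.+1 w) <= 4 * C / Num.sqrt (b n w).
Proof.
rewrite ler_wpM2l ?mulr_ge0 ?var_bound_ge0 //.
have b0 k : 0 < b k w by rewrite (lt_le_trans ltr01) // energy_ge1.
rewrite lef_pV2 ?posrE ?sqrtr_gt0 // ler_wsqrtr //.
by rewrite /b energyS lerDl sqr_ge0.
Qed.

(** The supermartingale inequality, atom by atom. If W is already frozen, only the energy moves, and
    it grows. Otherwise W_{n+1} is affine in a sum of centered variables, its second moment is
    explicit, and [potential_step] concludes. *)
Lemma potential_atom n w0 : (N <= n)%N ->
  (\int[P]_(w in atom n w0) (potential n.+1 w)%:E <=
   \int[P]_(w in atom n w0) (potential n w)%:E)%E.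
Proof.
move=> Nn; have mA := measurable_atom n w0.
have mp k : measurable_fun (atom n w0) (EFin \o potential k).
  by apply/measurable_EFinP; apply: measurable_funTS; exact: measurable_potential.
have [eW|We] := leP e `|W n w0|.
  apply: ge0_le_integral; [exact: mA | | exact: mp | exact: mp | ].
  - by move=> w _; rewrite lee_fin potential_ge0.
  - move=> w hw; rewrite lee_fin lerD ?sqrt_energy_step //.
    rewrite /W stopped_noise_frozen //.
    by rewrite (eq_stopped_noise _ _ _ _ hw).
set m := X n w0; set M : R := m%:R; set bn := b n w0; set bn' := b n.+1 w0.
have E1 : (\int[P]_(w in atom n w0) (potential n.+1 w)%:E =
   P (atom n w0) * ((bn * W n w0 / bn') ^+ 2 + (M / bn') ^+ 2 *
     (\sum_(i <- step_indices n m) var i) + 4 * C / Num.sqrt bn')%:E)%E.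
  transitivity (\int[P]_(w in atom n w0)
    (((bn * W n w0 / bn' + M / bn' * \sum_(i <- step_indices n m) ((Z i w)%:R - mean i)) ^+ 2)%R%:E
      + (4 * C / Num.sqrt bn')%R%:E))%E.
    apply: eq_integral => w; rewrite inE => hw; rewrite -EFinD; congr EFin.
    rewrite /potential (energy_adapted hw) -/bn'; congr (_ ^+ 2 + _).
    have -> : W n.+1 w = (b n w * W n w + (X n w)%:R * innovation alpha mu (X ^~ w) n) / b n.+1 w.
      rewrite /W /= ltnNge Nn /= (eq_stopped_noise _ _ _ _ hw) leNgt.
      by rewrite (We : `|stopped_noise alpha mu e N (X ^~ w0) n| < e).
    rewrite (energy_adapted hw) (innovation_step hw) (hw n) // /W.
    rewrite (eq_stopped_noise _ _ _ _ hw) -/bn'.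
    have -> : b n w = bn by apply: eq_energy => k kn; apply: hw; exact: ltnW.
    by rewrite mulrDl; congr (_ + _); rewrite mulrAC.
  rewrite ge0_integralD //; last 3 first.
  - by move=> w _; rewrite lee_fin sqr_ge0.
  - apply/measurable_EFinP; apply: measurable_funTS.
    apply: measurable_funX; apply: measurable_funD => //.
    apply: measurable_funM => //; apply: measurable_sum => i.
    apply: measurable_funB => //.
    by apply: (measurableT_comp (f := fun n : nat => n%:R : R) _ (measurable_inar_family i)).
  - by move=> w _; rewrite lee_fin divr_ge0 ?sqrtr_ge0 // mulr_ge0 // var_bound_ge0.
  rewrite integral_cst // (@integral_sqr_sum _ _ _ _ _ _ measurable_inar_family _ _ var
     [pred i | (stage i <= n)%N]); last 4 first.
  - exact: step_indices_uniq.
  - by move=> i /step_indices_stage; rewrite inE => ->; rewrite ltnn.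
  - by move=> i /step_indices_stage si; apply: mvZ; rewrite si.
  - exact: indep_outside_atom.
  by rewrite [in RHS]EFinD muleDr ?fin_num_measure //; congr (_ + _)%E; exact: muleC.
have E2 : (\int[P]_(w in atom n w0) (potential n w)%:E =
   P (atom n w0) * (potential n w0)%:E)%E.
  rewrite muleC -integral_cst //; apply: eq_integral => w; rewrite inE => hw.
  by rewrite (potential_adapted hw).
rewrite E1 E2 lee_wpmul2l // lee_fin.
have -> : bn' = bn + M ^+ 2 by rewrite /bn' /b energyS.
apply: potential_step; [exact: energy_ge1 | exact: var_bound_ge0 |].
(* There are m + 1 variables, each of variance at most C; this is the hypothesis on s in
   [potential_step]. *)
apply: (@le_trans _ _ (\sum_(i <- step_indices n m) C)).
  rewrite !big_seq; apply: ler_sum => i /step_indices_stage si.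
  by apply: varC; rewrite si.
by rewrite big_const_seq count_predT /= size_map size_iota iter_addr_0 mulrDr mulr1 mulr_natr addrC.
Qed.

Lemma potential_nonincreasing n : (N <= n)%N ->
  (\int[P]_w (potential n.+1 w)%:E <= \int[P]_w (potential n w)%:E)%E.
Proof.
(* Histories are encoded as integers, so that the fibers of the code are exactly the nonempty atoms,
   or empty. *)
move=> Nn; have mh : measurable_fun setT (fun w => pickle (history n w)).
  by apply: (@measurable_adapted _ _ n) => w w0 /history_atom ->.
have mp k : measurable_fun setT (EFin \o potential k).
  by apply/measurable_EFinP; exact: measurable_potential.
have p0 k w : (0 <= (EFin \o potential k) w)%E by rewrite lee_fin potential_ge0.
rewrite (integral_fiber P measurableT mh (mp n.+1) (p0 n.+1)).
rewrite (integral_fiber P measurableT mh (mp n) (p0 n)).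
apply: lee_nneseries => r *; first by apply: integral_ge0 => w _; exact: p0.
 have [[w0 hw0]|none] := pselect (exists w0, pickle (history n w0) = r).
  have -> : setT `&` (fun w => pickle (history n w)) @^-1` [set r] = atom n w0.
    rewrite setTI; apply/seteqP; split=> [w /= hw|w /history_atom /= ->] //.
    apply/history_atom; apply: (pcan_inj pickleK); by rewrite hw hw0.
  exact: potential_atom.
have -> : setT `&` (fun w => pickle (history n w)) @^-1` [set r] = set0.
  by rewrite setTI -subset0 => w hw; apply: none; exists w.
by rewrite !integral_set0.
Qed.

(** Markov's inequality at time n, then descent of the supermartingale to time N, where W = 0 and
    only the energy term is left. *)
Lemma stopped_noise_tail n : (N <= n)%N ->
  ((e ^+ 2)%:E * P [set w | e <= `|W n w| ]%R
   <= \int[P]_w (4 * C / Num.sqrt (b N w))%:E)%E.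
Proof.
move=> Nn.
have mW : measurable_fun setT (W n).
  by apply: (@measurable_adapted _ _ n) => w w0; exact: eq_stopped_noise.
have mS : measurable [set w | e <= `|W n w|].
  rewrite -[[set w | _]]setTI.
  by apply: measurable_fun_le => //; exact: measurableT_comp.
have mp : measurable_fun setT (EFin \o potential n).
  by apply/measurable_EFinP; exact: measurable_potential.
have p0 w : (0 <= (EFin \o potential n) w)%E by rewrite lee_fin potential_ge0.
apply: (@le_trans _ _ (\int[P]_w (potential n w)%:E)%E).
  rewrite -integral_cst //.
  apply: (@le_trans _ _ (\int[P]_(w in [set w | e <= `|W n w|]%R) (potential n w)%:E)%E).
    apply: ge0_le_integral => //.
    - by move=> w _; rewrite lee_fin sqr_ge0.
    - exact: measurable_funTS.
    - move=> w /= eW; rewrite lee_fin -[e ^+ 2]addr0 lerD //.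
        by rewrite -[W n w ^+ 2]real_normK ?num_real // ler_pXn2r // nnegrE ltW.
      by rewrite divr_ge0 ?sqrtr_ge0 // mulr_ge0 // var_bound_ge0.
  by apply: ge0_subset_integral => // w _; exact: p0.
apply: (@le_trans _ _ (\int[P]_w (potential N w)%:E)%E).
  elim: n Nn {mW mS mp p0} => [|n IH]; first by rewrite leqn0 => /eqP ->.
  rewrite leq_eqVlt => /predU1P[-> //|Nn].
  by apply: (le_trans (potential_nonincreasing Nn)); exact: IH.
rewrite le_eqVlt; apply/orP; left; apply/eqP/eq_integral => w _.
by rewrite /potential /W stopped_noise_start // expr0n add0r.
Qed.

End Stopping.

(** * Almost sure vanishing of the normalized noise *)

Hypothesis energy_ae : {ae P, forall w, (fun n => energy (X ^~ w) n : R) @ \oo --> +oo}.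

(** Dominated convergence; the energy is at least 1, so the constant 4 C dominates. *)
Lemma integral_sqrt_energy_cvg0 :
  (fun n => \int[P]_w (4 * C / Num.sqrt (energy (X ^~ w) n))%:E)%E @ \oo --> 0%E.
Proof.
have C0 := var_bound_ge0.
pose f_ n w : \bar R := (4 * C / Num.sqrt (energy (X ^~ w) n))%:E.
have mf n : measurable_fun setT (f_ n).
  apply: (@measurable_adapted _ _ n) => w w0 h; rewrite /f_.
  by rewrite (@eq_energy _ _ (X ^~ w0)) // => k kn; apply: h; exact: ltnW.
have ff : {ae P, forall w, setT w -> f_ ^~ w @ \oo --> cst 0%E w}.
  apply: filterS energy_ae => w Ew _; apply: cvg_EFin; first exact: nearW.
  rewrite -[X in _ --> X](mulr0 (4 * C)); apply: cvgM; first exact: cvg_cst.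
  have iE : (fun n => (energy (X ^~ w) n)^-1 : R) @ \oo --> 0.
    apply/gtr0_cvgV0 => //; near=> n.
    by rewrite (lt_le_trans ltr01) // energy_ge1.
  have sE : (fun n => Num.sqrt ((energy (X ^~ w) n)^-1) : R) @ \oo --> (0 : R).
    by rewrite -[X in _ --> X](@sqrtr0 R); apply: (continuous_cvg _ _ iE); exact: sqrt_continuous.
  apply: cvg_trans sE; apply: near_eq_cvg; near=> n.
  by rewrite /= sqrtrV // (le_trans ler01) // energy_ge1.
have fg : {ae P, forall w n, setT w -> (`|f_ n w| <= cst (4 * C)%:E w)%E}.
  apply: aeW => w n _; rewrite /f_ /= lee_fin.
  have s1 : 1 <= Num.sqrt (energy (X ^~ w) n) :> R.
    by rewrite -[X in X <= _](@sqrtr1 R) ler_wsqrtr // energy_ge1.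
  have s0 : 0 < Num.sqrt (energy (X ^~ w) n) :> R by apply: lt_le_trans s1.
  rewrite ger0_norm ?divr_ge0 ?mulr_ge0 ?sqrtr_ge0 // ler_pdivrMr //.
  by rewrite ler_peMr // mulr_ge0.
have ig : P.-integrable setT (cst (4 * C)%:E).
  exact: (finite_measure_integrable_cst P (4 * C)).
have [_ _] := dominated_convergence measurableT mf (measurable_cst _) ff ig fg.
by rewrite integral0.
Unshelve. all: by end_near. Qed.

Lemma noise_small_ae (e : R) : 0 < e -> {ae P, forall w, exists N, forall n, (N <= n)%N ->
  `|\sum_(N <= k < n) (X k w)%:R * innovation alpha mu (X ^~ w) k|
    <= e * energy (X ^~ w) n}.
Proof.
move=> e0; pose W N n w : R := stopped_noise alpha mu e N (X ^~ w) n.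
pose F N := \bigcup_n [set w | e <= `|W N n w|].
have mW N n : measurable [set w | e <= `|W N n w|].
  rewrite -[[set w | _]]setTI; apply: measurable_fun_le => //.
  apply: measurableT_comp => //.
  by apply: (@measurable_adapted _ _ n) => w w0; exact: eq_stopped_noise.
have mF N : measurable (F N) by exact: bigcupT_measurable.
have PF N : ((e ^+ 2)%:E * P (F N) <= \int[P]_w (4 * C / Num.sqrt (energy (X ^~ w) N))%:E)%E.
  (* Freezing makes the events at successive times increase, so the bound at a single time passes to
     their union over n. *)
  have ndW : nondecreasing_seq (fun n => [set w | e <= `|W N n w|]).
    apply/nondecreasing_seqP => n; apply/subsetPset => w /= eW.
    by rewrite /W stopped_noise_frozen.
  have h : ((fun n => (e ^+ 2)%:E * P [set w | e <= `|W N n w|]%R)%E @ \oo -->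
      ((e ^+ 2)%:E * P (F N))%E).
    apply: cvgeZl => //.
    exact: (nondecreasing_cvg_mu (mW N) (mF N) ndW).
  rewrite -(cvg_lim _ h) //; apply: lime_le; first by apply/cvg_ex; eexists; exact: h.
  near=> n; apply: stopped_noise_tail => //; near: n; exact: nbhs_infty_ge.
(* The intersection lies in every F N, whose probability is at most a multiple of an integral
   tending to 0. Off this null set some W started at N never freezes, hence is the true normalized
   noise. *)
have P0 : P (\bigcap_N F N) = 0%E.
  have mI : measurable (\bigcap_N F N) by exact: bigcapT_measurable.
  have le0 : ((e ^+ 2)%:E * P (\bigcap_N F N) <= 0)%E.
    rewrite -(cvg_lim _ integral_sqrt_energy_cvg0) //.
    apply: lime_ge; first by apply/cvg_ex; eexists; exact: integral_sqrt_energy_cvg0.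
    near=> N; apply: le_trans (PF N).
    rewrite lee_wpmul2l ?lee_fin ?sqr_ge0 // le_measure ?inE //.
    by move=> w; apply.
  apply/eqP; rewrite eq_le measure_ge0 andbT.
  by move: le0; rewrite pmule_rle0 // lte_fin exprn_gt0.
exists (\bigcap_N F N); split=> //; first exact: bigcapT_measurable.
move=> w /= nex N _; apply: contrapT => nF.
have We n : `|W N n w| < e.
  by rewrite ltNge; apply/negP => eW; apply: nF; exists n.
apply: nex; exists N => n Nn.
have E0 : 0 <= energy (X ^~ w) n :> R by rewrite (le_trans ler01) // energy_ge1.
rewrite -(stopped_noise_free We Nn) normrM (ger0_norm E0) mulrC.
by rewrite ler_wpM2r // ltW // We.
Unshelve. all: by end_near. Qed.

Lemma noise_ae : {ae P, forall w,
  (fun n => (\sum_(0 <= k < n) (X k w)%:R * innovation alpha mu (X ^~ w) k)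
     / energy (X ^~ w) n) @ \oo --> (0 : R)}.
Proof.
have h : {ae P, forall w, forall j : nat, exists N, forall n, (N <= n)%N ->
    `|\sum_(N <= k < n) (X k w)%:R * innovation alpha mu (X ^~ w) k|
    <= j.+1%:R^-1 * energy (X ^~ w) n}.
  by apply: ae_foralln => j; apply: noise_small_ae; rewrite invr_gt0.
by apply: filterS2 energy_ae h => w Ew hw; exact: noise_cvg0.
Qed.

End Inar.

(** * Almost sure divergence of the energy *)

Section Immigration.
Context {d : measure_display} {T : measurableType d} {R : realType}.
Variable P : probability T R.
Variables (X0 : T -> nat) (eps : nat -> T -> nat) (xi : nat -> nat -> T -> nat).
Hypothesis meps : forall k, measurable_fun setT (eps k).
Hypothesis indepZ : mutually_independent P (inar_family X0 eps xi).
Hypothesis eps_id : forall k (B : set nat), P (eps k @^-1` B) = P (eps 0%N @^-1` B).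
Hypothesis eps_neq0 : (0 < P [set w | eps 0%N w != 0%N])%E.

(** The immigration vanishes at all times from m on with probability at most q^n for every n, where
    q < 1 is the probability of the value 0. *)
Lemma immigration_io_ae : {ae P, forall w m, exists2 k, (m <= k)%N & (0 < eps k w)%N}.
Proof.
apply: ae_foralln => m.
have m0 k : measurable (eps k @^-1` [set 0%N]) by exact: measurable_preimage_nat.
pose A := \bigcap_k (eps (m + k)%N @^-1` [set 0%N]).
have mA : measurable A by exact: bigcapT_measurable.
pose q := fine (P (eps 0%N @^-1` [set 0%N])).
have qE : P (eps 0%N @^-1` [set 0%N]) = q%:E by rewrite fineK // fin_num_measure.
have q0 : 0 <= q by rewrite fine_ge0.
have q1 : q < 1.
  rewrite -lte_fin -qE.
  have -> : eps 0%N @^-1` [set 0%N] = ~` [set w | eps 0%N w != 0%N].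
    by apply/seteqP; split=> w /=; [move=> ->; rewrite eqxx | move/negP; rewrite negbK => /eqP].
  have mp : measurable [set w | eps 0%N w != 0%N].
    exact: (measurable_preimage_nat [set k | k != 0%N] (meps 0%N)).
  rewrite probability_setC // -(fineK (fin_num_measure P _ mp)) -EFinB lte_fin.
  by rewrite ltrBlDr ltrDl -lte_fin fineK // fin_num_measure.
have PA n : fine (P A) <= q ^+ n.
  rewrite -lee_fin fineK ?fin_num_measure //.
  pose l := [seq (inr (inl (m + k)%N) : unit + (nat + nat * nat)) | k <- iota 0 n].
  have ul : uniq l.
    by rewrite map_inj_uniq ?iota_uniq // => i j [] /addnI.
  have mB : measurable (\bigcap_(i in [set` l]) (inar_family X0 eps xi i @^-1` [set 0%N])).
    apply: fin_bigcap_measurable => // i /= /mapP[k _ ->]; exact: m0.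
  apply: (@le_trans _ _ (P (\bigcap_(i in [set` l]) (inar_family X0 eps xi i @^-1` [set 0%N])))).
    apply: le_measure; rewrite ?inE // => w Aw i /= /mapP[k _ ->]; exact: Aw.
  rewrite (indepZ ul (fun=> [set 0%N])) big_map.
  under eq_bigr do rewrite /= eps_id qE.
  by rewrite prodEFin big_const_seq count_predT size_iota iter_mulr_1.
have PA0 : P A = 0%E.
  rewrite -(fineK (fin_num_measure P _ mA)); congr EFin.
  apply/eqP; rewrite eq_le fine_ge0 // andbT.
  have h : (fun n => q ^+ n) @ \oo --> 0 by apply: cvg_expr; rewrite ger0_norm.
  rewrite -(cvg_lim _ h) //; apply: limr_ge; first by apply/cvg_ex; eexists; exact: h.
  by apply: nearW => n.
exists A; split=> // w /= nex k _ /=; apply: contrapT => ek; apply: nex.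
by exists (m + k)%N; [exact: leq_addr | rewrite lt0n; apply/eqP].
Qed.

Lemma energy_inarX_ae :
  {ae P, forall w, (fun n => energy (inarX X0 eps xi ^~ w) n : R) @ \oo --> +oo}.
Proof.
apply: filterS immigration_io_ae => w io; apply: energy_cvgy => m.
have [k mk ek] := io m; exists k.+1; first exact: leqW.
by rewrite /= addn_gt0 ek orbT.
Qed.

End Immigration.

(** * The regression coefficients *)

Section Regression.
Context {R : realType} (alpha mu theta : R) (s : nat) (u : nat -> nat).
Let y (k : nat) : R := (u k)%:R + (if k == s then theta else 0).
Let noise (n : nat) : R := \sum_(0 <= k < n) (u k)%:R * innovation alpha mu u k.

(** From n = s + 1 on, no term is excluded and the outlier is no longer read, so both sums have the
    same increments; all earlier discrepancies sit in c. *)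
Lemma regA_energy : exists c : R, forall n, (s < n)%N ->
  regA s n y = energy u n + c.
Proof.
exists (regA s s.+1 y - energy u s.+1) => n sn.
elim: n sn => [//|n IH]; rewrite ltnS leq_eqVlt => /predU1P[<-|sn].
  by rewrite addrC subrK.
rewrite energyS addrAC -IH // /regA [LHS]big_mkcond big_nat_recr //= -big_mkcond /=.
congr (_ + _); rewrite /nonoutlier eqSS !gtn_eqF // 1?ltnW //.
by rewrite /y gtn_eqF // addr0.
Qed.

(** The same argument, with (X_{n+1} - mu) X_n = alpha X_n^2 + X_n M_{n+1}. *)
Lemma regB_energy : exists c : R, forall n, (s < n)%N ->
  regB mu s n y = alpha * energy u n + noise n + c.
Proof.
exists (regB mu s s.+1 y - (alpha * energy u s.+1 + noise s.+1)) => n sn.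
elim: n sn => [//|n IH]; rewrite ltnS leq_eqVlt => /predU1P[<-|sn].
  by rewrite addrC subrK.
transitivity (regB mu s n y + ((u n.+1)%:R - mu) * (u n)%:R).
  rewrite /regB [LHS]big_mkcond big_nat_recr //= -big_mkcond /=.
  congr (_ + _); rewrite /nonoutlier eqSS !gtn_eqF // 1?ltnW //.
  by rewrite /y !gtn_eqF // 1?ltnW // !addr0.
have noiseS : noise n.+1 = noise n + (u n)%:R * innovation alpha mu u n.
  by rewrite /noise big_nat_recr.
rewrite IH // (energyS u n) noiseS /innovation; ring.
Qed.

Hypothesis energyoo : (fun n => energy u n : R) @ \oo --> +oo.
Hypothesis noise0 : (fun n => noise n / energy u n) @ \oo --> (0 : R).

Lemma regA_cvgy : (fun n => regA s n y) @ \oo --> +oo.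
Proof.
have [c Ac] := regA_energy; apply/cvgryPge => A; near=> n.
rewrite Ac; last by near: n; exact: nbhs_infty_gt.
rewrite -lerBlDr; near: n; by move/cvgryPge : energyoo; exact.
Unshelve. all: by end_near. Qed.

Lemma regB_div_regA_cvg : (fun n => regB mu s n y / regA s n y) @ \oo --> alpha.
Proof.
have [a Aa] := regA_energy; have [b Bb] := regB_energy.
have iE : (fun n => (energy u n)^-1 : R) @ \oo --> 0.
  apply/gtr0_cvgV0 => //; near=> n.
  by rewrite (lt_le_trans ltr01) // energy_ge1.
have cE (c : R) : (fun n => c * (energy u n)^-1) @ \oo --> 0.
  by rewrite -[X in _ --> X](mulr0 c); apply: cvgM => //; exact: cvg_cst.
have num : (fun n => alpha + noise n / energy u n + b * (energy u n)^-1) @ \oo --> alpha.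
  rewrite -[X in _ --> X]addr0; apply: cvgD => //.
  rewrite -[X in _ --> X]addr0; apply: cvgD => //; exact: cvg_cst.
have den : (fun n => 1 + a * (energy u n)^-1) @ \oo --> (1 : R).
  rewrite -[X in _ --> X]addr0; apply: cvgD => //; exact: cvg_cst.
have lim := cvgM num (cvgV (oner_neq0 R) den); rewrite invr1 mulr1 in lim.
suff tE : \forall n \near \oo,
    (alpha + noise n / energy u n + b * (energy u n)^-1) / (1 + a * (energy u n)^-1)
    = regB mu s n y / regA s n y.
  by apply: (cvg_trans (near_eq_cvg tE)); exact: lim.
near=> n.
have sn : (s < n)%N by near: n; exact: nbhs_infty_gt.
have E0 : 0 < energy u n :> R by rewrite (lt_le_trans ltr01) // energy_ge1.
have A0 : 0 < energy u n + a.
  rewrite -Aa // (lt_le_trans ltr01) //; near: n.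
  by move/cvgryPge : regA_cvgy; exact.
by rewrite Aa // Bb //; field; rewrite !gt_eqF.
Unshelve. all: by end_near. Qed.

End Regression.

(** * Strong consistency and the limit of the outlier estimator *)

Theorem theorem3p2p1 (R : realType) (d : measure_display) (T : measurableType d)
  (P : probability T R) (alpha : R) (X0 : T -> nat) (eps : nat -> T -> nat)
  (xi : nat -> nat -> T -> nat) (s theta : nat) :
  0 < alpha < 1 -> (0 < s)%N -> (0 < theta)%N ->
  measurable_fun setT X0 ->
  (forall k, measurable_fun setT (eps k)) ->
  (forall k j, measurable_fun setT (xi k j)) ->
  mutually_independent P (inar_family X0 eps xi) ->
  (forall k (B : set nat), P (eps k @^-1` B) = P (eps 0%N @^-1` B)) ->
  P.-integrable setT (fun w => (((eps 0%N w)%:R : R) ^+ 2)%:E) ->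
  (0 < P [set w | eps 0%N w != 0%N])%E ->
  (forall k j w, (xi k j w <= 1)%N) ->
  (forall k j, P (xi k j @^-1` [set 1%N]) = alpha%:E) ->
  P.-integrable setT (fun w => (((X0 w)%:R : R) ^+ 2)%:E) ->
  let mu : R := fine ('E_P[fun w => ((eps 0%N w)%:R : R)])%E in
  let Y : nat -> T -> R := inarY X0 eps xi s theta in
  {ae P, forall w, exists n0 : nat, forall n : nat, (n0 <= n)%N ->
      has_unique_global_min (Qn mu s n (Y ^~ w))} /\
  (forall atil ttil : nat -> T -> R,
     (forall n w, (s.+1 <= n)%N -> has_unique_global_min (Qn mu s n (Y ^~ w)) ->
        is_global_min (Qn mu s n (Y ^~ w)) (atil n w) (ttil n w)) ->
     {ae P, forall w, atil ^~ w @ \oo --> alpha} /\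
     {ae P, forall w, ttil ^~ w @ \oo -->
        Y s w - alpha / (1 + alpha ^+ 2) * (Y s.-1 w + Y s.+1 w)
              - (1 - alpha) / (1 + alpha ^+ 2) * mu}).
Proof.
move=> /andP[alpha0 alpha1] s0 theta0 mX0 meps mxi indep eps_id eps2 eps_neq0
  xi_le1 xi_alpha _ mu Y.
set Z := inar_family X0 eps xi.
have mZ : forall i, measurable_fun setT (Z i) := measurable_inar_family mX0 meps mxi.
have mZR i : measurable_fun setT (fun w => (Z i w)%:R : R).
  by apply: (measurableT_comp (f := fun n : nat => n%:R : R) _ (mZ i)).
pose mean i : R := fine (\int[P]_w ((Z i w)%:R : R)%:E)%E.
pose var i : R := fine (\int[P]_w (((Z i w)%:R - mean i) ^+ 2)%:E)%E.
have mean_eps k : mean (inr (inl k)) = mu.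
  rewrite /mean /mu unlock; congr fine.
  exact: (@eq_distribution_integral _ _ _ P (eps k) (eps 0%N)
    (fun r : nat => (r%:R : R)%:E)).
have xiE k j w : (xi k j w)%:R = \1_(xi k j @^-1` [set 1%N]) w :> R.
  rewrite indicE; case E: (xi k j w) (xi_le1 k j w) => [|[|//]] _.
    by rewrite memNset //= E.
  by rewrite mem_set //= E.
have mean_xi k j : mean (inr (inr (k, j))) = alpha.
  rewrite /mean /=; under eq_integral do rewrite xiE.
  rewrite integral_indic //; last exact: (measurable_preimage_nat _ (mxi k j)).
  by rewrite setIT; exact: (congr1 fine (xi_alpha k j)).
have sqr_int i : (0 < stage i)%N -> P.-integrable setT (fun w => (((Z i w)%:R : R) ^+ 2)%:E).
  case: i => [//|[k|[k j]]] _.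
    apply/integrableP; split; first by apply/measurable_EFinP; exact: measurable_funX.
    move/integrableP : eps2 => [_]; apply: le_lt_trans.
    rewrite le_eqVlt; apply/orP; left; apply/eqP.
    exact: (@eq_distribution_integral _ _ _ P (eps k) (eps 0%N)
      (fun r : nat => `|((r%:R : R) ^+ 2)%:E|%E)).
  apply: (le_integrable measurableT _ _ (finite_measure_integrable_cst P 1 measurableT)).
    by apply/measurable_EFinP; exact: measurable_funX.
  move=> w _ /=; rewrite lee_fin normrX normr1 expr_le1 //.
  by rewrite ger0_norm // lern1; exact: xi_le1.
have mv i : (0 < stage i)%N -> mean_var P (Z i) (mean i) (var i).
  by move=> i0; apply: mean_var_sqr_integrable; [exact: mZ | exact: sqr_int].
have var_eps k : var (inr (inl k)) = var (inr (inl 0%N)).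
  rewrite /var !mean_eps; congr (fine _).
  apply: (@eq_distribution_integral _ _ _ P (eps k) (eps 0%N)
    (fun r : nat => (((r%:R : R) - mu) ^+ 2)%:E)) => // r.
  by rewrite lee_fin sqr_ge0.
(* A Bernoulli variable differs from its mean by at most 1, so its variance is at most 1; all
   immigration variances agree with the first one. *)
have [C varC] : exists C, forall i, (0 < stage i)%N -> var i <= C.
  have v0 : 0 <= var (inr (inl 0%N)) by have [] := mv (inr (inl 0%N)) isT.
  exists (1 + var (inr (inl 0%N))) => -[//|[k|[k j]]] i0.
    by rewrite var_eps lerDr.
  rewrite -[var _]addr0 lerD // -lee_fin.
  (* Taking c = 0 and a = 1 in [mean_var] recovers the variance. *)
  have [_ /(_ 0 1)] := mv _ i0; rewrite expr0n expr1n mul1r add0r => <-.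
  rewrite -(integral_prob_cst P 1); apply: ge0_le_integral => //.
  - by move=> w _; rewrite lee_fin sqr_ge0.
  - apply/measurable_EFinP; apply: measurable_funX; apply: measurable_funD => //.
    by apply: measurable_funM => //; exact: measurable_funB.
  - move=> w _; rewrite lee_fin add0r mul1r mean_xi /Z /= xiE indicE.
    by case: (w \in xi k j @^-1` [set 1%N]); rewrite expr2 /=; nra.
(* One event of full probability on which both deterministic criteria for the least squares problem
   apply. *)
have good : {ae P, forall w, (fun n => regA s n (Y ^~ w)) @ \oo --> +oo /\
    (fun n => regB mu s n (Y ^~ w) / regA s n (Y ^~ w)) @ \oo --> alpha}.
  have Eae := energy_inarX_ae meps indep eps_id eps_neq0.
  have Nae := noise_ae mX0 meps mxi indep mv mean_eps mean_xi varC Eae.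
  apply: filterS2 Eae Nae => w Ew Nw; split; first exact: regA_cvgy.
  exact: regB_div_regA_cvg.
split.
  apply: filterS good => w [Aw _].
  have [n0 _ h] := Qn_has_unique_global_min mu Aw.
  by exists n0.
move=> atil ttil min_til.
have lim_til : {ae P, forall w, atil ^~ w @ \oo --> alpha /\
    ttil ^~ w @ \oo --> outlier_hat mu s (Y ^~ w) alpha}.
  apply: filterS good => w [Aw Bw]; apply: (global_min_cvg Aw Bw).
  have uw := Qn_has_unique_global_min mu Aw.
  near=> n; apply: min_til; near: n; [exact: nbhs_infty_ge | exact: uw].
split; first by apply: filterS lim_til => w [].
by apply: filterS lim_til => w [_].
Unshelve. all: by end_near. Qed.
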